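(* Let $X$ and $Y$ be independent random variables with $0<P\{Y>0\}\le P\{Y\ge0\}=1$, and let $(X_i,Y_i)$, $i\ge1$, be i.i.d. copies of $(X,Y)$. Let $T_n=\sum_{i=1}^nX_iY_i/\sum_{i=1}^nY_i$ (with $0/0:=0$), let $m(n)$ be the smallest $1\le m\le n$ such that $Y_m=\max\{Y_1,\dots,Y_n\}$, and put $A_n(\varepsilon)=\{Y_{m(n)}/\sum_{i=1}^nY_i>1-\varepsilon\}$ for $0<\varepsilon<1$. Assume that $E|X|<\infty$, that there is a subsequence $\{n'\}$ of $\{n\}$ with $$\lim_{\varepsilon\to0}\liminf_{n'\to\infty}P\{A_{n'}(\varepsilon)\}>0,$$ and that $P\{X=x_0\}>0$ for some $x_0\in\mathbb{R}$. Then there exists a subsequence $\{n'\}$ such that $$\lim_{\varepsilon\to0}\liminf_{n'\to\infty}P\{T_{n'}\in(x_0-\varepsilon,x_0+\varepsilon)\}>0.$$ Consequently there is a subsequence $\{n'\}$ and a random variable $T$ such that $T_{n'}\overset{\mathrm{D}}{\longrightarrow}T$ and $P\{T=x_0\}>0$. *)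

(* Defs.v *)
From HB Require Import structures.
From mathcomp Require Import all_boot all_order all_algebra finmap.
From mathcomp Require Import all_classical all_reals all_analysis.
From mathcomp Require Import measurable_realfun.

Set Implicit Arguments.
Unset Strict Implicit.
Unset Printing Implicit Defensive.

Import Order.TTheory GRing.Theory Num.Theory.
Import numFieldTopology.Exports numFieldNormedType.Exports.

Local Open Scope classical_set_scope.
Local Open Scope ring_scope.

Section pair.
Context {d d1 d2 : measure_display} {Om : measurableType d}
  {E1 : measurableType d1} {E2 : measurableType d2}.

Definition pairRV (X : {mfun Om >-> E1}) (Y : {mfun Om >-> E2}) :
  Om -> E1 * E2 := fun w => (X w, Y w).

Let measurable_pairRV X Y : measurable_fun setT (pairRV X Y).
Proof. exact: measurable_fun_pair. Qed.

HB.instance Definition _ X Y :=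
  isMeasurableFun.Build _ _ _ _ (pairRV X Y) (@measurable_pairRV X Y).

End pair.

Section random_elements.
Context {d d1 d2 : measure_display} {R : realType} {Om : measurableType d}
  {E1 : measurableType d1} {E2 : measurableType d2} (P : probability Om R).

Definition independent_pair (X : {RV P >-> E1}) (Y : {RV P >-> E2}) : Prop :=
  forall A B, measurable A -> measurable B ->
    P (X @^-1` A `&` Y @^-1` B) = (P (X @^-1` A) * P (Y @^-1` B))%E.

(* The two measures are compared on measurable sets only: the values of
   [distribution] elsewhere carry no meaning. *)
Definition identically_distributed (X Y : {RV P >-> E1}) : Prop :=
  forall A, measurable A -> distribution P X A = distribution P Y A.

Definition mutually_independent (Z_ : nat -> {RV P >-> E1}) : Prop :=
  forall (J : {fset nat}) (A_ : nat -> set E1),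
    (forall i, measurable (A_ i)) ->
    P (\bigcap_(i in [set` J]) (Z_ i @^-1` A_ i)) =
    (\prod_(i <- J) P (Z_ i @^-1` A_ i))%E.

Definition iid_copies (Z_ : nat -> {RV P >-> E1}) (Z : {RV P >-> E1}) : Prop :=
  mutually_independent Z_ /\ forall i, identically_distributed (Z_ i) Z.

End random_elements.

Arguments independent_pair {d d1 d2 R Om E1 E2} P X Y.
Arguments identically_distributed {d d1 R Om E1} P X Y.
Arguments mutually_independent {d d1 R Om E1} P Z_.
Arguments iid_copies {d d1 R Om E1} P Z_ Z.

Definition cvg_in_distribution {d d' : measure_display} {R : realType}
    {Om : measurableType d} {Om' : measurableType d'}
    (P : probability Om R) (P' : probability Om' R)
    (X_ : nat -> {RV P >-> R}) (X : {RV P' >-> R}) : Prop :=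
  forall r : R, {for r, continuous (cdf X)} ->
    cdf (X_ n) r @[n --> \oo] --> cdf X r.

Arguments cvg_in_distribution {d d' R Om Om'} P P' X_ X.

(* The indices of a subsequence of a sequence indexed by n >= 1. *)
Definition subsequence (s : nat -> nat) : Prop :=
  increasing_seq s /\ forall k, (0 < s k)%N.

(* Random variables indexed by i >= 1 are represented by sequences starting
   at 0, so that [X_ i] is the (i+1)-st variable and the first n variables are
   the [X_ i] for i < n. *)
Section self_normalized.
Context {d : measure_display} {R : realType} {Om : measurableType d}.

(* Division by zero in [R] yields 0, which is the convention 0/0 = 0. *)
Definition self_normalized_sum (X_ Y_ : nat -> {mfun Om >-> R}) (n : nat) : Om -> R :=
  fun w => (\sum_(i < n) X_ i w * Y_ i w) / (\sum_(i < n) Y_ i w).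

Let measurable_self_normalized_sum (X_ Y_ : nat -> {mfun Om >-> R}) n :
  measurable_fun setT (self_normalized_sum X_ Y_ n).
Proof.
have mV : measurable_fun setT (@GRing.inv R).
  have mC0 : measurable (~` [set 0 : R]) by exact: measurableC.
  rewrite -(setUv [set 0 : R]); apply/measurable_funU => //; split.
    exact: measurable_fun_set1.
  apply: subspace_continuous_measurable_fun => //.
  by apply: continuous_in_subspaceT => x /set_mem/eqP; exact: inv_continuous.
have mS (Z_ : nat -> Om -> R) : (forall i, measurable_fun setT (Z_ i)) ->
    measurable_fun setT (fun w => \sum_(i < n) Z_ i w).
  by move=> mZ; exact: measurable_sum.
apply: measurable_funM.
  by apply: (mS (fun i w => X_ i w * Y_ i w)) => i; exact: measurable_funM.
by apply: (measurableT_comp mV); exact: (mS (fun i w => Y_ i w)).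
Qed.

HB.instance Definition _ X_ Y_ n :=
  isMeasurableFun.Build _ _ _ _ (self_normalized_sum X_ Y_ n)
    (@measurable_self_normalized_sum X_ Y_ n).

(* Meaningful for n >= 1. *)
Definition argmax_index (Y_ : nat -> {mfun Om >-> R}) (n : nat) (w : Om) : nat :=
  find (fun m => Y_ m w == \big[Num.max/Y_ 0 w]_(i < n) Y_ i w) (iota 0 n).

Definition max_dominates (Y_ : nat -> {mfun Om >-> R}) (n : nat) (eps : R) : set Om :=
  [set w | Y_ (argmax_index Y_ n w) w / (\sum_(i < n) Y_ i w) > 1 - eps].

End self_normalized.

(* Main.v *)
(**
  The same subsequence works.  Put W_i = Y_i / sum_k Y_k, so that
  T_n - x0 = sum_i W_i (X_i - x0).  On the event that W_j > 1 - eps and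
  X_j = x0, the variable T_n deviates from x0 by at most
  sum_(i != j) W_i |X_i - x0|.  Since X_i is independent of the whole sequence
  Y, the mean of this sum on {W_j > 1 - eps} is at most
  eps E|X - x0| P{W_j > 1 - eps}.  Markov's inequality then gives
  P{|T_n - x0| < eta} >= P(A_n(eps)) P{X = x0} - eps E|X - x0| / eta,
  which is bounded below once eps is small compared with eta.  The laws of T_n
  are tight because P{|T_n| >= M} <= E|X| / M, and Helly's selection theorem
  provides the limit; the mass that stays in every neighbourhood of x0 becomes
  an atom.
*)

Require Import Defs.
From HB Require Import structures.
From mathcomp Require Import all_boot all_order all_algebra finmap.
From mathcomp Require Import all_classical all_reals all_analysis.
From mathcomp Require Import measurable_realfun lra ring.

Set Implicit Arguments.
Unset Strict Implicit.
Unset Printing Implicit Defensive.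

Import Order.TTheory GRing.Theory Num.Theory.
Import numFieldTopology.Exports numFieldNormedType.Exports.

Local Open Scope classical_set_scope.
Local Open Scope ring_scope.

(** * Independence: products of expectations and generated sigma-algebras *)

(** Independence says that the joint law agrees with the product of the marginal laws on rectangles,
    hence everywhere by uniqueness of the product measure; Tonelli's theorem then separates the two
    integrals. *)
Lemma ge0_expectation_mul d (Om : measurableType d) (R : realType)
    (P : probability Om R) (U V : {RV P >-> R}) :
  (forall w, 0 <= U w) -> (forall w, 0 <= V w) -> independent_pair P U V ->
  ('E_P[fun w => (U w * V w)%R] = 'E_P[U] * 'E_P[V])%E.
Proof.
move=> U0 V0 indUV.
pose muU := distribution P U; pose muV := distribution P V.
pose muUV := distribution P (pairRV U V).
have prodE A : measurable A -> (muU \x muV)%E A = muUV A.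
  apply: product_measure_unique => B C mB mC.
  exact: indUV.
(* The absolute values make the integrand nonnegative on the whole plane, as Tonelli requires, and
   change nothing on the range of [U] and [V]. *)
pose f (z : R * R) : \bar R := (`|z.1| * `|z.2|)%:E.
have mf : measurable_fun setT f.
  apply/measurable_EFinP; apply: measurable_funM.
    exact: (measurableT_comp (@normr_measurable _ _)).
  exact: (measurableT_comp (@normr_measurable _ _)).
have f0 z : (0 <= f z)%E by rewrite lee_fin mulr_ge0.
have -> : ('E_P[fun w => (U w * V w)%R] = \int[muUV]_z f z)%E.
  rewrite /muUV /distribution ge0_integral_pushforward//=.
  rewrite unlock; apply: eq_integral => w _.
  by rewrite /f /pairRV/= !ger0_norm.
have nrmE (W : {RV P >-> R}) : (forall w, 0 <= W w) ->
    (\int[distribution P W]_x (`|x|)%:E = 'E_P[W])%E.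
  move=> W0; rewrite ge0_integral_pushforward//.
  - rewrite unlock; apply: eq_integral => w _.
    by rewrite /= ger0_norm.
  - by apply/measurable_EFinP.
rewrite (eq_measure_integral (muU \x muV)%E); last first.
  by move=> A mA _; apply/esym; exact: prodE.
rewrite fubini_tonelli1// /fubini_F.
under eq_integral => x _.
  rewrite /f/=. under eq_integral => y _ do rewrite EFinM.
  rewrite ge0_integralZl//; last first.
    exact/measurable_EFinP.
  rewrite nrmE//. over.
rewrite /= ge0_integralZr//; last 2 first.
  exact/measurable_EFinP.
  by apply: expectation_ge0.
by rewrite nrmE.
Qed.

(** Dynkin's pi-lambda argument: the events independent of [A] are stable under complements and
    disjoint countable unions. Measurability of [F] travels with the conclusion because both closure
    steps use it. *)
Lemma indep_g_sigma_algebra d (Om : measurableType d) (R : realType)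
    (P : probability Om R) (A : set Om) (G : set (set Om)) :
  measurable A -> setI_closed G -> G `<=` measurable ->
  (forall F, G F -> (P (A `&` F) = P A * P F)%E) ->
  forall F, <<s G >> F -> measurable F /\ (P (A `&` F) = P A * P F)%E.
Proof.
move=> mA GI mG indG.
apply: (@dynkin_induction _ (g_sigma_algebraType G) G) => //.
- by rewrite setIT probability_setT mule1; split.
- by move=> F GF; split; [exact: mG|exact: indG].
- move=> F _ [mF indF]; split; first exact: measurableC.
  rewrite -setDE measureD//; last by rewrite -ge0_fin_numE// fin_num_measure.
  transitivity (P A - P A * P F)%E; first by congr (_ - _)%E.
  by rewrite probability_setC// muleBr ?mule1// fin_num_measure.
- move=> F _ tF indF; split.
    by apply: (@bigcup_measurable _ Om) => k _; case: (indF k).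
  have mF k : measurable (F k : set Om) by case: (indF k).
  have sigma (B : set Om) : measurable B ->
      P (B `&` \bigcup_k F k) = (\sum_(0 <= k <oo) P (B `&` F k))%E.
    move=> mB; rewrite setI_bigcupr measure_bigcup//.
    - by apply: eq_eseriesl => k; rewrite mem_setT.
    - by move=> k _; exact: measurableI.
    - exact: trivIset_setIl.
  rewrite sigma// -[in RHS](setTI (\bigcup_k F k)) sigma//.
  have PAE : P A = (fine (P A))%:E by rewrite fineK// fin_num_measure.
  rewrite PAE -nneseriesZl// -PAE.
  by apply: eq_eseriesr => k _; rewrite setTI; case: (indF k).
Qed.

Lemma measurable_invr (R : realType) : measurable_fun setT (@GRing.inv R).
Proof.
have mC0 : measurable (~` [set 0 : R]) by exact: measurableC.
rewrite -(setUv [set 0 : R]); apply/measurable_funU => //; split.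
  exact: measurable_fun_set1.
apply: subspace_continuous_measurable_fun => //.
by apply: continuous_in_subspaceT => x /set_mem/eqP; exact: inv_continuous.
Qed.

(** A pi-system of rectangles that generates the sigma-algebra of the first [n] variables [Y_ j];
    that sigma-algebra is written [<<s cylinder Y_ n >>] below. *)
Definition cylinder d (Om : measurableType d) (R : realType)
    (Y_ : nat -> {mfun Om >-> R}) (n : nat) : set (set Om) :=
  [set F | exists2 B : nat -> set R, (forall j, measurable (B j)) &
     F = \bigcap_(j in `I_n) Y_ j @^-1` B j].

Lemma cylinder_setI_closed d (Om : measurableType d) (R : realType)
  (Y_ : nat -> {mfun Om >-> R}) n : setI_closed (cylinder Y_ n).
Proof.
move=> _ _ [B mB ->] [C mC ->]; exists (fun j => B j `&` C j).
  by move=> j; exact: measurableI.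
by rewrite -bigcapI.
Qed.

Lemma measurable_cylinder d (Om : measurableType d) (R : realType)
  (Y_ : nat -> {mfun Om >-> R}) n : cylinder Y_ n `<=` measurable.
Proof.
move=> _ [B mB ->]; apply: bigcap_measurableType => j _.
exact: measurable_funPTI.
Qed.

(** * Independence of each [X_ i] from the first [n] variables [Y_ j] *)

Section independent_copies.
Context (R : realType) (d : measure_display) (Om : measurableType d)
  (P : probability Om R) (X Y : {RV P >-> R}) (X_ Y_ : nat -> {RV P >-> R}).
Hypothesis indXY : independent_pair P X Y.
Hypothesis copies : iid_copies P (fun i => pairRV (X_ i) (Y_ i)) (pairRV X Y).

Let preimageX (U V : {RV P >-> R}) A B :
  pairRV U V @^-1` (A `*` B) = U @^-1` A `&` V @^-1` B.
Proof. by []. Qed.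

Lemma copy_fst i A : measurable A -> P (X_ i @^-1` A) = P (X @^-1` A).
Proof.
move=> mA; have := copies.2 i _ (measurableX mA measurableT).
by rewrite /distribution/= /pushforward !preimageX !preimage_setT !setIT.
Qed.

Lemma copy_snd i B : measurable B -> P (Y_ i @^-1` B) = P (Y @^-1` B).
Proof.
move=> mB; have := copies.2 i _ (measurableX measurableT mB).
by rewrite /distribution/= /pushforward !preimageX !preimage_setT !setTI.
Qed.

Lemma copy_rect i A B : measurable A -> measurable B ->
  (P (X_ i @^-1` A `&` Y_ i @^-1` B) = P (X_ i @^-1` A) * P (Y_ i @^-1` B))%E.
Proof.
move=> mA mB; rewrite (copy_fst _ mA) (copy_snd _ mB) -(indXY mA mB).
exact: (copies.2 i _ (measurableX mA mB)).
Qed.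

Let prodE (J : {fset nat}) (A B : nat -> set R) :
  (forall j, measurable (A j)) -> (forall j, measurable (B j)) ->
  (P (\bigcap_(j in [set` J]) (X_ j @^-1` A j `&` Y_ j @^-1` B j)) =
   (\prod_(j <- J) P (X_ j @^-1` A j)) * \prod_(j <- J) P (Y_ j @^-1` B j))%E.
Proof.
move=> mA mB.
have := copies.1 J (fun j => A j `*` B j) (fun j => measurableX (mA j) (mB j)).
move=> /= ->; rewrite -big_split/=; apply: eq_bigr => j _.
by rewrite preimageX; exact: copy_rect.
Qed.

(** Both events are intersections over one finite index set, with [setT] in the coordinates left
    free, so [prodE] factors the joint probability and each of the two separate ones. The index [i]
    may lie below [n]: independence inside the pair covers that case. *)
Lemma copy_fst_indep_cylinder i n A F : measurable A -> cylinder Y_ n F ->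
  (P (X_ i @^-1` A `&` F) = P (X_ i @^-1` A) * P F)%E.
Proof.
move=> mA [B mB ->].
(* The set has to contain [i] as well as all indices below [n], whichever is larger. *)
pose J : {fset nat} := [fset j in iota 0 (maxn n i.+1)]%fset.
have memJ j : (j \in J) = (j < maxn n i.+1)%N by rewrite !inE mem_iota.
pose A' j := if j == i then A else setT.
pose B' j := if (j < n)%N then B j else setT.
have mA' j : measurable (A' j) by rewrite /A'; case: ifP.
have mB' j : measurable (B' j) by rewrite /B'; case: ifP.
have iJ : i \in J by rewrite memJ leq_max leqnn orbT.
have AE : X_ i @^-1` A = \bigcap_(j in [set` J]) X_ j @^-1` A' j.
  apply/seteqP; split=> w /=.
    by move=> Aw j _; rewrite /= /A'; case: eqP => // ->.
  by move=> /(_ i iJ); rewrite /= /A' eqxx.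
have BE : \bigcap_(j in `I_n) Y_ j @^-1` B j =
    \bigcap_(j in [set` J]) Y_ j @^-1` B' j.
  apply/seteqP; split=> w /= Bw j jJ; rewrite /=.
    by rewrite /B'; case: ifPn => // jn; exact: Bw.
  have /Bw : [set` J] j by rewrite /= memJ leq_max jJ.
  by rewrite /= /B' jJ.
have PT (Z : nat -> {RV P >-> R}) :
    (\prod_(j <- J) P (Z j @^-1` setT) = 1)%E.
  by rewrite big1// => j _; rewrite preimage_setT probability_setT.
have PA : (P (X_ i @^-1` A) = \prod_(j <- J) P (X_ j @^-1` A' j))%E.
  have := prodE J mA' (fun=> measurableT); rewrite PT mule1 => <-.
  by rewrite AE; congr (P _); apply: eq_bigcapr => j _; rewrite preimage_setT setIT.
have PB : (P (\bigcap_(j in `I_n) Y_ j @^-1` B j) =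
    \prod_(j <- J) P (Y_ j @^-1` B' j))%E.
  have := prodE J (fun=> measurableT) mB'; rewrite PT mul1e => <-.
  by rewrite BE; congr (P _); apply: eq_bigcapr => j _; rewrite preimage_setT setTI.
by rewrite PA PB -prodE// {}AE {}BE -bigcapI.
Qed.

Lemma copy_fst_indep i n A F : measurable A -> <<s cylinder Y_ n >> F ->
  measurable F /\ (P (X_ i @^-1` A `&` F) = P (X_ i @^-1` A) * P F)%E.
Proof.
move=> mA; apply: indep_g_sigma_algebra.
- exact: measurable_funPTI.
- exact: cylinder_setI_closed.
- exact: measurable_cylinder.
- by move=> C; exact: copy_fst_indep_cylinder.
Qed.

Lemma measurable_fun_sigma_cylinder n (F : Om -> R) :
  measurable_fun setT (F : g_sigma_algebraType (cylinder Y_ n) -> R) ->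
  measurable_fun setT F.
Proof.
move=> mF _ B mB; rewrite setTI.
have := mF measurableT B mB; rewrite setTI => FB.
(* Only the measurability half is used here, so the index and the event are arbitrary. *)
exact: (copy_fst_indep 0%N measurableT FB).1.
Qed.

Lemma expectation_copy_fst i (h : R -> R) :
  measurable_fun setT h -> (forall x, 0 <= h x) ->
  ('E_P[h \o X_ i] = 'E_P[h \o X])%E.
Proof.
move=> mh h0; pose f x := (h x)%:E.
have mf : measurable_fun setT f by exact/measurable_EFinP.
have distE (Z : {RV P >-> R}) : ('E_P[h \o Z] = \int[distribution P Z]_x f x)%E.
  rewrite ge0_integral_pushforward//; last by move=> x _; rewrite /f lee_fin.
  by rewrite unlock.
rewrite !distE; apply: eq_measure_integral => A mA _.
exact: copy_fst.
Qed.

(** Preimages under [F] lie in the sigma-algebra of the [Y_ j] and preimages under [h \o X_ i] are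
    events of [X_ i], so the two functions are independent and the product rule applies. *)
Lemma expectation_mul_copy_fst i n (F : Om -> R) (h : R -> R) :
  measurable_fun setT (F : g_sigma_algebraType (cylinder Y_ n) -> R) ->
  (forall w, 0 <= F w) -> measurable_fun setT h -> (forall x, 0 <= h x) ->
  ('E_P[fun w => (F w * h (X_ i w))%R] = 'E_P[F] * 'E_P[h \o X])%E.
Proof.
move=> mF F0 mh h0.
have mF' := measurable_fun_sigma_cylinder mF.
have mhX : measurable_fun setT (h \o X_ i) by exact: measurableT_comp.
pose U : {RV P >-> R} := mfun_Sub (mem_set mF').
pose V : {RV P >-> R} := mfun_Sub (mem_set mhX).
have UE : (U : Om -> R) = F by exact: mfun_valP.
have VE : (V : Om -> R) = h \o X_ i by exact: mfun_valP.
have indUV : independent_pair P U V.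
  move=> A B mA mB; rewrite UE VE.
  have FA : <<s cylinder Y_ n >> (F @^-1` A).
    by have := mF measurableT A mA; rewrite setTI.
  have mhB : measurable (h @^-1` B) by rewrite -[_ @^-1` _]setTI; exact: mh.
  have [_] := copy_fst_indep i mhB FA.
  by rewrite setIC muleC.
have := ge0_expectation_mul _ _ indUV.
rewrite UE VE => ->//; last by move=> w; exact: h0.
by rewrite expectation_copy_fst.
Qed.

Lemma measurable_cylinder_coord n j : (j < n)%N ->
  measurable_fun setT (Y_ j : g_sigma_algebraType (cylinder Y_ n) -> R).
Proof.
move=> jn _ B mB; rewrite setTI; apply: sub_sigma_algebra.
exists (fun k => if k == j then B else setT).
  by move=> k; case: ifP.
apply/seteqP; split=> w /=.
  by move=> Bw k _; rewrite /=; case: eqP => // ->.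
by move=> /(_ j jn); rewrite /= eqxx.
Qed.

(** * Weighted sums of the [h (X_ i)] with coefficients depending on the [Y_ j] alone *)

Lemma expectation_weighted_sum n (F : 'I_n -> Om -> R) (h : R -> R) :
  (forall i, measurable_fun setT (F i : g_sigma_algebraType (cylinder Y_ n) -> R)) ->
  (forall i w, 0 <= F i w) -> measurable_fun setT h -> (forall x, 0 <= h x) ->
  ('E_P[fun w => (\sum_(i < n) F i w * h (X_ i w))%R] =
   'E_P[fun w => (\sum_(i < n) F i w)%R] * 'E_P[h \o X])%E.
Proof.
move=> mF F0 mh h0.
have sumE (G : 'I_n -> Om -> R) : (forall i, measurable_fun setT (G i)) ->
    (forall i w, 0 <= G i w) ->
    ('E_P[fun w => (\sum_(i < n) G i w)%R] = \sum_(i < n) 'E_P[G i])%E.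
  move=> mG G0; rewrite unlock.
  rewrite -(@ge0_integral_sum _ _ _ P _ measurableT _ (fun i w => (G i w)%:E))//.
  - by apply: eq_integral => w _; rewrite sumEFin.
  - by move=> i; exact/measurable_EFinP.
  - by move=> i w _; rewrite lee_fin.
have mF' i : measurable_fun setT (F i) by exact: measurable_fun_sigma_cylinder.
rewrite !sumE//; last 2 first.
- move=> i; apply: measurable_funM => //.
  exact: (measurableT_comp mh).
- by move=> i w; rewrite mulr_ge0.
rewrite ge0_sume_distrl; last by move=> i _; exact: expectation_ge0.
by apply: eq_bigr => i _; exact: expectation_mul_copy_fst.
Qed.

(** Markov's inequality, the mean being factored by independence. It serves twice: with the
    non-dominant weights in [dominant_close], and with all weights for tightness. *)
Lemma weighted_sum_tail n (F : 'I_n -> Om -> R) (h : R -> R) (eta : R) :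
  (forall i, measurable_fun setT (F i : g_sigma_algebraType (cylinder Y_ n) -> R)) ->
  (forall i w, 0 <= F i w) -> measurable_fun setT h -> (forall x, 0 <= h x) ->
  0 < eta ->
  (eta%:E * P [set w | eta <= \sum_(i < n) F i w * h (X_ i w)]%R <=
   'E_P[fun w => (\sum_(i < n) F i w)%R] * 'E_P[h \o X])%E.
Proof.
move=> mF F0 mh h0 eta0.
rewrite -expectation_weighted_sum//.
pose Z w := \sum_(i < n) F i w * h (X_ i w).
have Z0 w : 0 <= Z w by apply: sumr_ge0 => i _; rewrite mulr_ge0.
have mZ : measurable_fun setT Z.
  apply: measurable_sum => i; apply: measurable_funM.
    exact: measurable_fun_sigma_cylinder.
  exact: (measurableT_comp mh).
have mZE : measurable_fun setT (EFin \o Z) by exact/measurable_EFinP.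
rewrite (_ : [set w | _] = setT `&` [set w | (eta%:E <= `|(EFin \o Z) w|)%E]); last first.
  by rewrite setTI; apply/seteqP; split=> w /=; rewrite lee_fin ger0_norm.
apply: (le_trans (le_integral_abse P measurableT mZE eta0)).
rewrite unlock; apply: ge0_le_integral => //.
- exact: measurableT_comp.
- by move=> w _; rewrite /= lee_fin ger0_norm.
Qed.

(** * A single dominant weight and the deviation from [x0] *)

Lemma measurable_cylinder_ratio n j : (j < n)%N ->
  measurable_fun setT
    ((fun w => Y_ j w / \sum_(i < n) Y_ i w) : g_sigma_algebraType (cylinder Y_ n) -> R).
Proof.
move=> jn; apply: measurable_funM; first exact: measurable_cylinder_coord.
apply: (measurableT_comp (@measurable_invr R)).
by apply: measurable_sum => i; exact: measurable_cylinder_coord.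
Qed.

(* For [eps <= 1/2] these events are disjoint in [j], and almost surely their
   union contains [max_dominates Y_ n eps]: the argmax never has to be made
   measurable. *)
Definition dominant n (eps : R) (j : nat) : set Om :=
  [set w | (forall i, (i < n)%N -> 0 <= Y_ i w) /\
           1 - eps < Y_ j w / \sum_(i < n) Y_ i w].

Lemma cylinder_nonneg n :
  <<s cylinder Y_ n >> [set w | forall i, (i < n)%N -> 0 <= Y_ i w].
Proof.
apply: sub_sigma_algebra; exists (fun=> `[0, +oo[%classic) => //.
by apply/seteqP; split=> w /= Yw i /Yw; rewrite /= in_itv/= andbT.
Qed.

Lemma cylinder_dominant n eps j : (j < n)%N ->
  <<s cylinder Y_ n >> (dominant n eps j).
Proof.
move=> jn.
have mr := measurable_cylinder_ratio jn.
have /(_ _ (measurable_itv `]1 - eps, +oo[)) := mr measurableT.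
rewrite setTI => mdom.
rewrite (_ : dominant n eps j = [set w | forall i, (i < n)%N -> 0 <= Y_ i w] `&`
  ((fun w => Y_ j w / \sum_(i < n) Y_ i w) @^-1` `]1 - eps, +oo[%classic)).
  exact: (@measurableI _ (g_sigma_algebraType (cylinder Y_ n)) _ _
    (@cylinder_nonneg n) mdom).
by apply/seteqP; split=> w /=; rewrite /dominant/= in_itv/= andbT.
Qed.

Lemma sigma_cylinder_measurable n F : <<s cylinder Y_ n >> F -> measurable F.
Proof. by move=> sF; exact: (copy_fst_indep 0%N measurableT sF).1. Qed.

Lemma dominant_sum_gt0 n eps j w : eps <= 1 -> dominant n eps j w ->
  0 < \sum_(i < n) Y_ i w.
Proof.
move=> eps1 [Y0 Yj]; rewrite lt_neqAle; apply/andP; split; last first.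
  by apply: sumr_ge0 => i _; exact: Y0.
(* A zero total would make the ratio zero by convention, against [1 - eps >= 0]. *)
apply/negP => /eqP S0; move: Yj; rewrite -S0 invr0 mulr0 subr_lt0.
by rewrite ltNge eps1.
Qed.

Lemma sum_ratio n w : 0 < \sum_(i < n) Y_ i w ->
  \sum_(j < n) Y_ j w / (\sum_(i < n) Y_ i w) = 1.
Proof. by move=> S0; rewrite -mulr_suml divff// gt_eqF. Qed.

Lemma self_normalized_sum_dev n w x0 : 0 < \sum_(i < n) Y_ i w ->
  `|self_normalized_sum X_ Y_ n w - x0| <=
  \sum_(j < n) `|Y_ j w / (\sum_(i < n) Y_ i w)| * `|X_ j w - x0|.
Proof.
move=> S0; rewrite (_ : _ - _ =
    \sum_(j < n) (Y_ j w / (\sum_(i < n) Y_ i w)) * (X_ j w - x0)).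
  by apply: (le_trans (ler_norm_sum _ _ _)); apply: ler_sum => i _; rewrite normrM.
under eq_bigr do rewrite mulrBr.
rewrite sumrB -mulr_suml sum_ratio// mul1r; congr (_ - _).
by rewrite /self_normalized_sum mulr_suml; apply: eq_bigr => i _; ring.
Qed.

(** When [X_ j] equals [x0] the dominant term contributes no deviation, and the other weights have
    total at most [eps], so Markov's inequality controls the rest. The error keeps the factor
    [P (dominant n eps j)] so that its sum over the disjoint events stays bounded uniformly in
    [n]. *)
Lemma dominant_close n (j : 'I_n) (eps eta x0 : R) : 0 <= eps <= 1 -> 0 < eta ->
  (eta%:E * (P [set w | X w = x0]%R * P (dominant n eps j)) <=
   eta%:E * P ([set w | `|self_normalized_sum X_ Y_ n w - x0| < eta]%R `&`
               dominant n eps j)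
   + eps%:E * P (dominant n eps j) * 'E_P[fun w => `|X w - x0|%R])%E.
Proof.
move=> /andP[eps0 eps1] eta0.
pose A := dominant n eps j.
pose T := self_normalized_sum X_ Y_ n.
have sA : <<s cylinder Y_ n >> A by exact: cylinder_dominant.
have mA : measurable A by exact: sigma_cylinder_measurable sA.
(* The coefficients are the weights other than the [j]-th, restricted to [A]. The restriction keeps
   them functions of the [Y_ j], and brings the factor [P A] into the bound on their mean. *)
pose F (i : 'I_n) w : R :=
  if i == j then 0 else \1_A w * `|Y_ i w / (\sum_(i < n) Y_ i w)|.
pose h x : R := `|x - x0|.
have mh : measurable_fun setT h.
  apply: (measurableT_comp (@normr_measurable _ _)).
  exact: measurable_funB.
have h0 x : 0 <= h x by exact: normr_ge0.
have mF i : measurable_fun setT (F i : g_sigma_algebraType (cylinder Y_ n) -> R).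
  rewrite /F; case: eqP => [_|_]; first exact: measurable_cst.
  apply: measurable_funM; first exact: measurable_indic.
  apply: (measurableT_comp (@normr_measurable _ _)).
  exact: measurable_cylinder_ratio.
have F0 i w : 0 <= F i w by rewrite /F; case: eqP => // _; rewrite mulr_ge0.
have tail := weighted_sum_tail mF F0 mh h0 eta0.
have EF : ('E_P[fun w => (\sum_(i < n) F i w)%R] <= eps%:E * P A)%E.
  have -> : (eps%:E * P A = \int[P]_w (eps * \1_A w)%:E)%E.
    under eq_integral do rewrite EFinM.
    rewrite ge0_integralZl//; last by apply/measurable_EFinP; exact: measurable_indic.
    by rewrite integral_indic// setIT.
  rewrite unlock; apply: ge0_le_integral => //.
  - by move=> w _; rewrite lee_fin sumr_ge0.
  - apply/measurable_EFinP; apply: measurable_sum => i.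
    exact: measurable_fun_sigma_cylinder.
  - by apply/measurable_EFinP; apply: measurable_funM; first exact: measurable_cst.
  move=> w _; rewrite lee_fin indicE; case: (boolP (w \in A)) => wA; last first.
    rewrite mulr0 big1// => i _; rewrite /F; case: eqP => // _.
    by rewrite indicE (negbTE wA) mul0r.
  move/set_mem : wA => wA; have S0 := dominant_sum_gt0 eps1 wA.
  rewrite mulr1 (bigD1 j)//= /F eqxx add0r.
  have [Y0 Yj] := wA.
  have rE : 1 - Y_ j w / (\sum_(i < n) Y_ i w) =
      \sum_(i < n | i != j) Y_ i w / (\sum_(i < n) Y_ i w).
    by rewrite -[in LHS](sum_ratio S0) (bigD1 j)//= addrAC subrr add0r.
  rewrite (_ : \sum_(i < n | i != j) _ = 1 - Y_ j w / (\sum_(i < n) Y_ i w)).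
    by rewrite lerBlDr -lerBlDl ltW.
  rewrite rE; apply: eq_bigr => i /negbTE ->.
  rewrite indicE mem_set// mul1r ger0_norm// divr_ge0//; first exact: Y0.
  exact: ltW.
pose C : set Om := [set w | `|T w - x0| < eta].
pose tailset : set Om := [set w | eta <= \sum_(i < n) F i w * h (X_ i w)].
have mtail : measurable tailset.
  pose Z w := \sum_(i < n) F i w * h (X_ i w).
  have mZ : measurable_fun setT Z.
    apply: measurable_sum => i; apply: measurable_funM.
      exact: measurable_fun_sigma_cylinder.
    exact: (measurableT_comp mh).
  rewrite (_ : tailset = Z @^-1` `[eta, +oo[).
    by rewrite -[_ @^-1` _]setTI; exact: mZ.
  by apply/seteqP; split=> w /=; rewrite in_itv/= andbT.
have mC : measurable C.
  rewrite (_ : C = (h \o T) @^-1` `]-oo, eta[).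
    by rewrite -[_ @^-1` _]setTI; apply: (measurableT_comp mh).
  by apply/seteqP; split=> w /=; rewrite in_itv.
(* Either the sum of the other terms reaches [eta], or it is below [eta] and bounds the deviation,
   the [j]-th term being zero. *)
have sub : X_ j @^-1` [set x0] `&` A `<=`
    (C `&` A) `|` tailset.
  move=> w [Xj wA]; have S0 := dominant_sum_gt0 eps1 wA.
  have [|lt_eta] := leP eta (\sum_(i < n) F i w * h (X_ i w)); first by right.
  left; split => //=; apply: le_lt_trans lt_eta.
  apply: (le_trans (self_normalized_sum_dev x0 S0)).
  apply: ler_sum => i _; rewrite /F; case: eqP => [->|_].
    by rewrite Xj subrr normr0 mulr0 mul0r.
  by rewrite indicE mem_set// mul1r.
(* The event [A] involves only the [Y_ j], so it is independent of [X_ j] taking the value [x0]. *)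
have [_ PD] := copy_fst_indep j (measurable_set1 x0) sA.
rewrite (copy_fst _ (measurable_set1 x0)) in PD.
rewrite -[X in (P X * _)%E]/(X @^-1` [set x0]) -PD.
apply: (@le_trans _ _ (eta%:E * (P (C `&` A) + P tailset))%E).
  rewrite lee_pmul2l//; apply: (@le_trans _ _ (P ((C `&` A) `|` tailset))).
    rewrite le_measure ?inE//.
      by apply: measurableI => //; exact: measurable_funPTI.
    by apply: measurableU => //; exact: measurableI.
  by apply: measureU2 => //; exact: measurableI.
rewrite ge0_muleDr//; apply: leeD => //.
apply: (le_trans tail); apply: lee_wpmul2r => //.
by apply: expectation_ge0 => w; exact: h0.
Qed.

(** * The maximal weight: summation over its possible indices *)

Lemma argmax_indexP n w : (0 < n)%N ->
  (argmax_index Y_ n w < n)%N /\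
  Y_ (argmax_index Y_ n w) w = \big[Num.max/Y_ 0 w]_(i < n) Y_ i w.
Proof.
move=> n0; set M := \big[_/_]_(i < n) _.
have hasM : has (fun m => Y_ m w == M) (iota 0 n).
  (* The seed [Y_ 0 w] of the maximum is itself one of the terms since [n] is positive, so the
     maximum is attained. *)
  have [m mn ->] : exists2 m, (m < n)%N & M = Y_ m w.
    apply: (big_ind (fun z => exists2 m, (m < n)%N & z = Y_ m w))
      => [|_ _ [i iN ->] [j jN ->]|i _]; first by exists 0%N.
      by rewrite /Order.max; case: ifP => _; [exists j|exists i].
    by exists i.
  by apply/hasP; exists m; rewrite ?mem_iota.
have := nth_find 0%N hasM; rewrite has_find size_iota in hasM.
by rewrite -/(argmax_index Y_ n w) nth_iota// add0n => /eqP.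
Qed.

(** Only the value at the argmax enters, and this value is a finite maximum of measurable
    functions. *)
Lemma measurable_max_dominates n eps : (0 < n)%N ->
  measurable (max_dominates Y_ n eps).
Proof.
move=> n0; pose M w := \big[Num.max/Y_ 0 w]_(i < n) Y_ i w.
have mM : measurable_fun setT M.
  rewrite /M; elim: (index_enum _) => [|i s IH].
    by under eq_fun do rewrite big_nil; exact: measurable_funPT.
  by under eq_fun do rewrite big_cons; apply: measurable_maxr.
have mr : measurable_fun setT (fun w => M w / \sum_(i < n) Y_ i w).
  apply: measurable_funM => //; apply: (measurableT_comp (@measurable_invr R)).
  exact: measurable_sum.
rewrite (_ : max_dominates _ _ _ =
    (fun w => M w / \sum_(i < n) Y_ i w) @^-1` `]1 - eps, +oo[).
  by rewrite -[_ @^-1` _]setTI; exact: mr.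
apply/seteqP; split=> w; rewrite /max_dominates/= in_itv/= andbT;
  by rewrite (argmax_indexP w n0).2.
Qed.

(** Two weights above one half would have sum above one, while all weights are nonnegative with
    total one. *)
Lemma trivIset_dominant n eps : eps <= 2^-1 ->
  trivIset setT (fun j : 'I_n => dominant n eps j).
Proof.
move=> eps2; apply/trivIsetP => i j _ _ ij.
rewrite -subset0 => w [[Y0 Yi] [_ Yj]].
have S0 : 0 < \sum_(k < n) Y_ k w.
  by apply: (@dominant_sum_gt0 n eps i) => //; lra.
have := sum_ratio S0; move: S0 Yi Yj; set S := \sum_(k < n) Y_ k w => S0 Yi Yj.
have ji : j != i by rewrite eq_sym.
rewrite (bigD1 i)//= (bigD1 j)//=.
set r := \sum_(_ < _ | _) _; have : 0 <= r.
  apply: sumr_ge0 => k _; apply: divr_ge0; first exact: Y0.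
  exact: ltW.
by lra.
Qed.

Hypothesis Y_ge0 : P [set w | 0 <= Y w]%R = 1%E.

Lemma nonneg_ae n : P (~` [set w | forall i, (i < n)%N -> 0 <= Y_ i w]) = 0%E.
Proof.
have mN i : measurable (Y_ i @^-1` `]-oo, 0[) by exact: measurable_funPTI.
have N0 i : P.-negligible (Y_ i @^-1` `]-oo, 0[).
  apply/negligibleP => //; apply: (etrans (copy_snd _ (measurable_itv _))).
  rewrite (_ : _ @^-1` _ = ~` [set w | 0 <= Y w]).
    rewrite probability_setC ?Y_ge0 ?subee//.
    rewrite (_ : [set w | _] = Y @^-1` `[0, +oo[); first exact: measurable_funPTI.
    by apply/seteqP; split=> w /=; rewrite in_itv/= andbT.
  by apply/seteqP; split=> w /=; rewrite in_itv/= ltNge => /negP.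
apply: measure_negligible.
  by apply: measurableC; exact: sigma_cylinder_measurable (@cylinder_nonneg n).
apply: (negligibleS _ (negligible_bigcup N0)).
move=> w /existsNP[i] /not_implyP[_ /negP]; rewrite -ltNge => Yi.
by exists i; rewrite //= in_itv.
Qed.

(** Outside the null event of a negative [Y_ i], the argmax index [j] witnesses membership in
    [dominant n eps j]; disjointness turns the measure of the union into a sum. *)
Lemma max_dominates_le n eps : (0 < n)%N -> eps <= 2^-1 ->
  (P (max_dominates Y_ n eps) <= \sum_(j < n) P (dominant n eps j))%E.
Proof.
move=> n0 eps2.
have mdom (j : 'I_n) : measurable (dominant n eps j).
  by apply: sigma_cylinder_measurable (@cylinder_dominant n eps j _).
have mN : measurable [set w | forall i, (i < n)%N -> 0 <= Y_ i w].
  exact: sigma_cylinder_measurable (@cylinder_nonneg n).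
have mU : measurable (\big[setU/set0]_(j < n) dominant n eps j).
  exact: bigsetU_measurable.
rewrite -measure_bigsetU_ord//; last exact: trivIset_dominant.
rewrite -[leRHS]adde0 -[X in (_ + X)%E](nonneg_ae n).
apply: le_trans (measureU2 _ _ _) => //; last exact: measurableC.
rewrite le_measure ?inE//.
- exact: measurable_max_dominates.
- by apply: measurableU => //; exact: measurableC.
move=> w wM.
have [Y0|] := pselect (forall i, (i < n)%N -> 0 <= Y_ i w); last by right.
left; have [mn _] := argmax_indexP w n0.
by rewrite -bigcup_mkord; exists (argmax_index Y_ n w).
Qed.

(** The estimate [dominant_close] is summed over [j]. Disjointness bounds the main terms by the
    probability of being close to [x0], and the total mass in the error terms by one. *)
Lemma max_dominates_close n (eps eta x0 : R) : (0 < n)%N ->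
  0 <= eps <= 2^-1 -> 0 < eta ->
  (eta%:E * (P [set w | X w = x0]%R * P (max_dominates Y_ n eps)) <=
   eta%:E * P [set w | `|self_normalized_sum X_ Y_ n w - x0| < eta]%R
   + eps%:E * 'E_P[fun w => `|X w - x0|%R])%E.
Proof.
move=> n0 /andP[eps0 eps2] eta0.
pose C : set Om := [set w | `|self_normalized_sum X_ Y_ n w - x0| < eta].
have mC : measurable C.
  rewrite (_ : C = self_normalized_sum X_ Y_ n @^-1` `]x0 - eta, x0 + eta[).
    exact: measurable_funPTI.
  by apply/seteqP; split=> w; rewrite /C/= in_itv/= ltr_distl.
have mdom (j : 'I_n) : measurable (dominant n eps j).
  by apply: sigma_cylinder_measurable (@cylinder_dominant n eps j _).
have tdom := @trivIset_dominant n eps eps2.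
have sumC : (\sum_(j < n) P (C `&` dominant n eps j) <= P C)%E.
  rewrite -measure_bigsetU_ord//; last 2 first.
  - by move=> j; exact: measurableI.
  - exact: trivIset_setIl.
  rewrite -big_distrr/= le_measure ?inE//.
  by apply: measurableI => //; exact: bigsetU_measurable.
have sum1 : (\sum_(j < n) P (dominant n eps j) <= 1)%E.
  rewrite -measure_bigsetU_ord//; apply: probability_le1.
  exact: bigsetU_measurable.
have EX0 : (0 <= 'E_P[fun w => `|X w - x0|%R])%E by exact: expectation_ge0.
apply: (@le_trans _ _ (\sum_(j < n) (eta%:E * P (C `&` dominant n eps j) +
    eps%:E * P (dominant n eps j) * 'E_P[fun w => `|X w - x0|%R]))%E).
  apply: (@le_trans _ _ (\sum_(j < n)
      (eta%:E * (P [set w | X w = x0]%R * P (dominant n eps j))))%E).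
    rewrite -ge0_sume_distrr; last by move=> i _; rewrite mule_ge0.
    rewrite lee_pmul2l// -ge0_sume_distrr//.
    by rewrite lee_wpmul2l//; exact: max_dominates_le.
  apply: lee_sum => j _; apply: dominant_close => //.
  by rewrite eps0; lra.
rewrite big_split/= -ge0_sume_distrr// -ge0_sume_distrl; last first.
  by move=> i _; rewrite mule_ge0// lee_fin.
apply: leeD; first by rewrite lee_wpmul2l// lee_fin ltW.
rewrite lee_wpmul2r// -ge0_sume_distrr// -[leRHS]mule1.
by rewrite lee_wpmul2l// lee_fin.
Qed.

(** * Tightness of the self-normalized sums *)

(** Almost surely the sum is at most the weighted mean of the [|X_ i|], with weights of total at
    most one; Markov's inequality gives a bound free of [n]. *)
Lemma self_normalized_sum_tail n (M : R) : 0 < M ->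
  (M%:E * P [set w | M <= `|self_normalized_sum X_ Y_ n w|]%R <=
   'E_P[fun w => `|X w|%R])%E.
Proof.
move=> M0.
pose A : set Om := [set w | forall i, (i < n)%N -> 0 <= Y_ i w].
pose T := self_normalized_sum X_ Y_ n.
have sA : <<s cylinder Y_ n >> A by exact: (@cylinder_nonneg n).
have mA : measurable A by exact: sigma_cylinder_measurable sA.
pose F (i : 'I_n) w : R := \1_A w * `|Y_ i w / (\sum_(i < n) Y_ i w)|.
have mh : measurable_fun setT (fun x : R => `|x|) by exact: normr_measurable.
have h0 (x : R) : 0 <= `|x| by exact: normr_ge0.
have mF i : measurable_fun setT (F i : g_sigma_algebraType (cylinder Y_ n) -> R).
  apply: measurable_funM; first exact: measurable_indic.
  apply: (measurableT_comp (@normr_measurable _ _)).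
  exact: measurable_cylinder_ratio.
have F0 i w : 0 <= F i w by rewrite mulr_ge0.
have F1 w : \sum_(i < n) F i w <= 1.
  rewrite -mulr_sumr indicE; case: (boolP (w \in A)) => [/set_mem Y0|_]; last first.
    by rewrite mul0r.
  rewrite mul1r.
  have S0 : 0 <= \sum_(i < n) Y_ i w by apply: sumr_ge0 => i _; exact: Y0.
  under eq_bigr => i _ do rewrite ger0_norm ?divr_ge0// ?Y0//.
  (* If the total is zero, all ratios vanish by convention, so the weights sum to 0 instead of 1. *)
  have [S1|S1] := ltP 0 (\sum_(i < n) Y_ i w); first by rewrite sum_ratio.
  have -> : \sum_(i < n) Y_ i w = 0 by apply/eqP; rewrite eq_le S1.
  by rewrite invr0 -mulr_suml mulr0.
have := weighted_sum_tail mF F0 mh h0 M0.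
pose B : set Om := [set w | M <= \sum_(i < n) F i w * `|X_ i w|].
have mB : measurable B.
  pose Z w := \sum_(i < n) F i w * `|X_ i w|.
  have mZ : measurable_fun setT Z.
    apply: measurable_sum => i; apply: measurable_funM.
      exact: measurable_fun_sigma_cylinder.
    exact: (measurableT_comp mh).
  rewrite (_ : B = Z @^-1` `[M, +oo[).
    by rewrite -[_ @^-1` _]setTI; exact: mZ.
  by apply/seteqP; split=> w /=; rewrite in_itv/= andbT.
rewrite -/B => tail.
apply: (@le_trans _ _ (M%:E * P B)%E); last first.
  apply: (le_trans tail); rewrite -[leRHS]mul1e lee_wpmul2r//.
    by apply: expectation_ge0 => w; exact: h0.
  rewrite -(expectation_cst P 1) unlock; apply: ge0_le_integral => //.
  - by move=> w _; rewrite lee_fin sumr_ge0.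
  - apply/measurable_EFinP; apply: measurable_sum => i.
    exact: measurable_fun_sigma_cylinder.
  - by apply/measurable_EFinP; exact: measurable_cst.
  - by move=> w _; rewrite lee_fin.
rewrite lee_pmul2l// -[leRHS]adde0 -[X in (_ + X)%E](nonneg_ae n).
apply: le_trans (measureU2 _ _ _) => //; last exact: measurableC.
rewrite le_measure ?inE//.
- rewrite (_ : [set w | _] = (Num.norm \o T) @^-1` `[M, +oo[).
    by rewrite -[_ @^-1` _]setTI; apply: (measurableT_comp mh).
  by apply/seteqP; split=> w /=; rewrite in_itv/= andbT.
- by apply: measurableU => //; exact: measurableC.
move=> w MT; have [wA|] := pselect (A w); last by right.
left; apply: (le_trans MT).
rewrite /self_normalized_sum mulr_suml; apply: (le_trans (ler_norm_sum _ _ _)).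
apply: ler_sum => i _; rewrite /F indicE mem_set// mul1r -normrM.
by rewrite [X in _ <= `|X|]mulrC mulrA.
Qed.

End independent_copies.

(** * Helly's selection principle through an ultrafilter limit *)

(** Compactness yields a cluster point; an ultrafilter contains the preimage of each neighbourhood
    or of its complement, and clustering excludes the latter. *)
Lemma ultra_cvg_compact (I : Type) (T : topologicalType) (U : set_system I)
    (K : set T) (f : I -> T) :
  UltraFilter U -> compact K -> (\forall i \near U, K (f i)) ->
  exists2 p, K p & f @ U --> p.
Proof.
move=> UU cK UK.
have [p [Kp clp]] := cK _ (fmap_proper_filter f _) UK.
exists p => // A Ap.
have [//|UnA] := in_ultra_setVsetC (f @^-1` A) UU.
by have [y [nAy Ay]] := clp (~` A) A UnA Ap.
Qed.

Section helly.
Context (R : realType).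
Implicit Types (F : nat -> R -> R).

(* An ultrafilter yields a limit at every real at once, with no diagonal
   extraction; the subsequence is chosen afterwards to match this limit on a
   countable dense set. *)
Lemma ultralimit F : (forall k x, 0 <= F k x <= 1) ->
  exists U, [/\ UltraFilter U, \oo `<=` U &
    exists L : R -> R, forall x, F k x @[k --> U] --> L x].
Proof.
move=> F01; have [U [UU oU]] := ultraFilterLemma eventually_filter.
exists U; split => //.
suff /choice[L FL] : forall x, exists l : R, F k x @[k --> U] --> l by exists L.
move=> x; have [|l _ Fl] := ultra_cvg_compact (f := F ^~ x) UU (@segment_compact R 0 1).
  by apply: nearW => k; rewrite /= in_itv/= F01.
by exists l.
Qed.

(** The indices at which the first [m] points [q i] are within [1 / (m + 1)] of the limit form a set
    of [U]. Since [U] refines [\oo], such an index exists beyond any given one, and [s] picks them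
    recursively. *)
Lemma ultralimit_subsequence F (U : set_system nat) (L : R -> R) (q : nat -> R) :
  UltraFilter U -> \oo `<=` U -> (forall x, F k x @[k --> U] --> L x) ->
  exists2 s : nat -> nat, increasing_seq s &
    forall i, F (s k) (q i) @[k --> \oo] --> L (q i).
Proof.
move=> UU oU FL.
have near_all m : \forall k \near U, forall i, (i < m)%N ->
    `|L (q i) - F k (q i)| < m.+1%:R^-1.
  have : forall m' e, 0 < e -> \forall k \near U, forall i, (i < m')%N ->
      `|L (q i) - F k (q i)| < e.
    elim=> [e e0|m' IH e e0]; first exact: nearW.
    have {}IH := IH e e0; have /cvgrPdist_lt/(_ e e0) Fm := FL (q m').
    apply: filterS2 IH Fm => k IHk Fk i; rewrite ltnS leq_eqVlt => /predU1P[->//|].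
    exact: IHk.
  by apply; rewrite invr_gt0.
have next m N : exists k, (N < k)%N /\
    forall i, (i < m)%N -> `|L (q i) - F k (q i)| < m.+1%:R^-1.
  have : U [set k | (N < k)%N /\ (forall i, (i < m)%N ->
      `|L (q i) - F k (q i)| < m.+1%:R^-1)].
    by apply: filterI; [apply: oU; exact: nbhs_infty_gt|exact: near_all].
  by move=> /filter_ex[k ?]; exists k.
have {next} /choice[g gP] : forall mN : nat * nat, exists k, (mN.2 < k)%N /\
    forall i, (i < mN.1)%N -> `|L (q i) - F k (q i)| < mN.1.+1%:R^-1.
  by move=> [m N]; exact: next.
pose s := fix s m := if m is m'.+1 then g (m, s m') else g (0%N, 0%N).
have sP m i : (i < m)%N -> `|L (q i) - F (s m) (q i)| < m.+1%:R^-1.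
  by case: m => [//|m]; exact: (gP (m.+1, s m)).2.
exists s.
  by apply/increasing_seqP => m; exact: (gP (m.+1, s m)).1.
move=> i; apply/cvgrPdist_lt => e e0; near=> k.
have ik : (i < k)%N by near: k; exact: nbhs_infty_gt.
apply: (lt_trans (sP _ _ ik)).
by near: k; exact: near_infty_natSinv_lt (PosNum e0).
Unshelve. all: by end_near. Qed.

Variables (F : nat -> R -> R) (U : set_system nat) (L : R -> R).
Hypothesis ndF : forall k, {homo F k : x y / x <= y}.
Hypothesis F01 : forall k x, 0 <= F k x <= 1.
Hypothesis UU : UltraFilter U.
Hypothesis FL : forall x, F k x @[k --> U] --> L x.

Let L01 x : 0 <= L x <= 1.
Proof.
apply/andP; split.
  by apply: (cvgr_to_ge (@FL x)); apply: nearW => k; case/andP: (F01 k x).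
by apply: (cvgr_to_le (@FL x)); apply: nearW => k; case/andP: (F01 k x).
Qed.

Let ndL : {homo L : x y / x <= y}.
Proof.
move=> x y xy; apply: (ler_cvg_to (@FL x) (@FL y)).
by apply: nearW => k; exact: ndF.
Qed.

(** The pointwise limit [L] is monotone but may fail to be right-continuous, as a distribution
    function must be; the right limit repairs this and differs from [L] at most at its
    discontinuities. *)
Definition right_regularization (x : R) : R := inf (L @` `]x, +oo[).
Local Notation G := right_regularization.

Let lbL (x : R) : lbound (L @` `]x, +oo[) 0.
Proof. by move=> _ [y _ <-]; case/andP: (L01 y). Qed.

Let neL (x : R) : L @` `]x, +oo[ !=set0.
Proof. by exists (L (x + 1)), (x + 1) => //=; rewrite in_itv/= andbT ltrDl. Qed.

Lemma le_regularization x : L x <= G x.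
Proof.
apply: lb_le_inf; first exact: neL.
by move=> _ [y /= + <-]; rewrite in_itv/= andbT => /ltW/ndL.
Qed.

(** With [le_regularization], this places [G x] between [L x] and [L y] for [y > x]; the comparisons
    of [G] with the [F k] below rest on this sandwich. *)
Lemma regularization_le x y : x < y -> G x <= L y.
Proof.
move=> xy; apply: inf_lbound; first by exists 0; exact: lbL.
by exists y => //=; rewrite in_itv/= andbT.
Qed.

Lemma regularization_nondecreasing : {homo G : x y / x <= y}.
Proof.
move=> x y; rewrite le_eqVlt => /predU1P[->//|xy].
exact: le_trans (regularization_le xy) (le_regularization y).
Qed.

Lemma regularization_right_continuous : right_continuous G.
Proof.
move=> x; apply/cvgrPdist_lt => e e0.
have [_ [y /= + <-] Lye] := inf_adherent e0 (conj (neL x) (ex_intro _ 0 (@lbL x))).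
rewrite in_itv/= andbT => xy.
near=> z; have xz : x < z by near: z; exact: nbhs_right_gt.
have zy : z < y by near: z; exact: nbhs_right_lt.
rewrite distrC ger0_norm ?subr_ge0; last first.
  by apply: regularization_nondecreasing; exact: ltW.
by rewrite ltrBlDl; apply: le_lt_trans (regularization_le zy) Lye.
Unshelve. all: by end_near. Qed.

(** Monotonicity traps [F (s k) r] between its values at two points of [q] on either side of [r].
    Their limits are at least [G (r - d / 2)] and at most [G (q j)], both within [e / 2] of [G r] by
    continuity. *)
Lemma regularization_cvg (s : nat -> nat) (q : nat -> R) :
  (forall x y : R, x < y -> exists i, x < q i < y) ->
  (forall i, F (s k) (q i) @[k --> \oo] --> L (q i)) ->
  forall r, {for r, continuous G} -> F (s k) r @[k --> \oo] --> G r.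
Proof.
move=> q_dense Fsq r cG; apply/cvgrPdist_lt => e e0.
have e20 : 0 < e / 2 by rewrite divr_gt0.
have /cvgrPdist_lt/(_ _ e20)/nbhs_ballP[d /= d0 Gd] := cG.
have [i /andP[ri1 ri2]] := q_dense (r - d / 2) r ltac:(lra).
have [j /andP[rj1 rj2]] := q_dense r (r + d / 2) ltac:(lra).
have Gi : `|G r - G (r - d / 2)| < e / 2.
  by apply: Gd; rewrite /ball/= opprB addrC subrK ger0_norm; lra.
have Gj : `|G r - G (q j)| < e / 2.
  by apply: Gd; rewrite /ball/= distrC ger0_norm; lra.
have /cvgrPdist_lt/(_ _ e20) Fi := Fsq i.
have /cvgrPdist_lt/(_ _ e20) Fj := Fsq j.
have Li := regularization_le ri1.
have Lj := le_regularization (q j).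
near=> k.
have : `|L (q i) - F (s k) (q i)| < e / 2 by near: k.
have : `|L (q j) - F (s k) (q j)| < e / 2 by near: k.
have := ndF (s k) (ltW ri2); have := ndF (s k) (ltW rj1).
move: Gi Gj; rewrite !ltr_norml; lra.
Unshelve. all: by end_near. Qed.

Lemma regularization_lower x c :
  (\forall k \near U, c <= F k x) -> c <= G x.
Proof.
move=> cF; apply: le_trans (le_regularization x).
exact: cvgr_to_ge (@FL x) cF.
Qed.

Lemma regularization_upper x y c : x < y ->
  (\forall k \near U, F k y <= c) -> G x <= c.
Proof.
move=> xy cF; apply: le_trans (regularization_le xy) _.
exact: cvgr_to_le (@FL y) cF.
Qed.

(** The gap between [a'] and [a] gives [G a' <= L a]; at the right endpoint [L b <= G b]
    suffices. *)
Lemma regularization_diff a' a b c : a' < a ->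
  (\forall k \near U, c <= F k b - F k a) -> c <= G b - G a'.
Proof.
move=> a'a cF; apply: (@le_trans _ _ (L b - L a)).
  exact: cvgr_to_ge (cvgB (@FL b) (@FL a)) cF.
by rewrite lerB ?le_regularization// regularization_le.
Qed.

End helly.

(** * Distribution functions and atoms *)

(** The probability is the Lebesgue-Stieltjes measure of [G] on the line, and the variable is the
    identity. *)
Lemma cdf_realization (R : realType) (G : R -> R) :
  {homo G : x y / x <= y} -> right_continuous G ->
  G @ -oo --> (0 : R) -> G @ +oo --> (1 : R) ->
  exists (d : measure_display) (Om : measurableType d) (P : probability Om R)
         (T : {RV P >-> R}), forall r, cdf T r = (G r)%:E.
Proof.
move=> ndG rcG GN0 Gy1.
pose Gc : cumulativeBounded (0 : R) (1 : R) := HB.pack G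
  (isCumulative.Build R _ R G ndG rcG)
  (isCumulativeBounded.Build R 0 1 G GN0 Gy1).
pose P : probability (measurableTypeR R) R := lebesgue_stieltjes_measure Gc.
pose T : {RV P >-> R} := HB.pack (idfun : measurableTypeR R -> R)
  (@isMeasurableFun.Build _ _ _ _ (idfun : measurableTypeR R -> R)
     (@measurable_id _ _ setT)).
by exists _, _, P, T => r; exact: (cdf_lebesgue_stieltjes_id Gc r).
Qed.

Section atoms.
Context (R : realType) (d : measure_display) (Om : measurableType d)
  (P : probability Om R).

Lemma cdfE (T : {RV P >-> R}) r : cdf T r = P (T @^-1` `]-oo, r]).
Proof. by []. Qed.

Lemma cdf_itv (T : {RV P >-> R}) a b : a <= b ->
  (P (T @^-1` `]a, b]) = cdf T b - cdf T a)%E.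
Proof.
move=> ab; rewrite !cdfE.
have -> : `]a, b]%classic = `]-oo, b] `\` `]-oo, a].
  by rewrite -[RHS]setCK setCD setCitvl setUC -[LHS]setCK setCitv.
rewrite -[_ @^-1` _]/((T @^-1` `]-oo, b]) `\` (T @^-1` `]-oo, a])).
have mT I : measurable (T @^-1` [set` Interval (BInfty R true) I]).
  exact: measurable_funPTI.
rewrite measureD//=; [|exact: mT..|]; last first.
  by rewrite -ge0_fin_numE// fin_num_measure//; exact: mT.
congr (_ - P _)%E; rewrite setIidr//; apply: preimage_subset.
exact: subset_itvl.
Qed.

(** Continuity from above along intervals shrinking to [x]. They are half-open so that [cdf_itv]
    measures them. *)
Lemma atom_ge (T : {RV P >-> R}) (x : R) (c : \bar R) :
  (forall e : R, 0 < e -> (c <= P (T @^-1` `](x - e)%R, (x + e)%R]))%E) ->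
  (c <= P (T @^-1` [set x]))%E.
Proof.
move=> cP; pose B n := T @^-1` `]x - n.+1%:R^-1, x + n.+1%:R^-1].
have mB n : measurable (B n) by exact: measurable_funPTI.
have BE : T @^-1` [set x] = \bigcap_n B n.
  apply/seteqP; split=> w /= => [Tx n _|Bw].
    by rewrite /B/= Tx in_itv/= ltrBlDr ltrDl lerDl invr_ge0 invr_gt0 ltr0n/=.
  apply/eqP/negP => /negP Tx.
  have e0 : 0 < `|T w - x| by rewrite normr_gt0 subr_eq0.
  have [n _ nP] := near_infty_natSinv_lt (PosNum e0).
  have := nP n (leqnn n); have := Bw n I; rewrite /B/= in_itv/=.
  move: (n.+1%:R^-1) => r /andP[B1 B2].
  by rewrite ltNge => /negP; apply; rewrite ler_norml; apply/andP; split; lra.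
rewrite BE; have : P \o B @ \oo --> P (\bigcap_n B n).
  apply: nonincreasing_cvg_mu => //.
  - by rewrite -ge0_fin_numE// fin_num_measure.
  - by rewrite -BE; exact: measurable_funPTI.
  - move=> m n mn; apply/subsetPset; apply: preimage_subset; apply: subset_itv;
    by rewrite bnd_simp ?lerD2l ?lerN2 lef_pV2 ?posrE// ler_nat.
move/cvge_to_ge; apply; apply: nearW => n; apply: cP.
by rewrite invr_gt0.
Qed.

End atoms.

(** * Limits in distribution of tight sequences, with preservation of atoms *)

Section helly_cvg_in_distribution.
Context (R : realType) (d : measure_display) (Om : measurableType d)
  (P : probability Om R) (T_ : nat -> {RV P >-> R}) (c : R).
Hypothesis tight : forall k (M : R), 0 < M ->
  (M%:E * P [set w | M <= `|T_ k w|]%R <= c%:E)%E.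

Let F k x := fine (cdf (T_ k) x).

Let FE k x : (F k x)%:E = cdf (T_ k) x.
Proof. by rewrite fineK// fin_num_measure. Qed.

Let ndF k : {homo F k : x y / x <= y}.
Proof. by move=> x y xy; rewrite -lee_fin !FE; exact: cdf_nondecreasing. Qed.

Let F01 k x : 0 <= F k x <= 1.
Proof. by rewrite -!lee_fin FE cdf_ge0 cdf_le1. Qed.

Let mtail k (M : R) : measurable [set w | M <= `|T_ k w|]%R.
Proof.
rewrite (_ : [set w | _] = (Num.norm \o T_ k) @^-1` `[M, +oo[).
  rewrite -[_ @^-1` _]setTI; apply: measurableT_comp => //.
by apply/seteqP; split=> w /=; rewrite in_itv/= andbT.
Qed.

Let tail k (M : R) : 0 < M -> (P [set w | M <= `|T_ k w|]%R <= (c / M)%:E)%E.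
Proof.
move=> M0; rewrite -(@lee_pmul2l _ M%:E)// -EFinM mulrCA divff ?gt_eqF// mulr1.
exact: tight.
Qed.

Let F_lower k (M : R) : 0 < M -> F k (- M) <= c / M.
Proof.
move=> M0; rewrite -lee_fin FE; apply: le_trans (tail k M0).
rewrite cdfE le_measure ?inE//; first exact: measurable_funPTI.
move=> w /=; rewrite in_itv/= => TM.
by rewrite ler0_norm; lra.
Qed.

Let F_upper k (M : R) : 0 < M -> 1 - c / M <= F k M.
Proof.
move=> M0; rewrite lerBlDr -lee_fin EFinD FE.
apply: (@le_trans _ _ (cdf (T_ k) M + P [set w | M <= `|T_ k w|]%R)%E); last first.
  by rewrite leeD2l// tail.
rewrite cdfE -(probability_setT P); apply: le_trans (measureU2 _ _ _) => //; last first.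
  exact: measurable_funPTI.
rewrite le_measure ?inE//.
  by apply: measurableU => //; exact: measurable_funPTI.
move=> w _ /=; have [TM|MT] := leP (T_ k w) M; first by left; rewrite in_itv.
by right; rewrite (le_trans (ltW MT))// ler_norm.
Qed.

(** Tightness makes the limits of [G] at the infinities 0 and 1, so no mass escapes. The statement
    on atoms is proved together with convergence because it is read off the construction of [T]: a
    bound valid eventually holds along [U], hence passes to increments of [G]. *)
Lemma helly_cvg_in_distribution :
  exists2 s : nat -> nat, increasing_seq s &
  exists (d' : measure_display) (Om' : measurableType d')
         (P' : probability Om' R) (T : {RV P' >-> R}),
    cvg_in_distribution P P' (T_ \o s) T /\
    forall x l, (forall e, 0 < e -> \forall k \near \oo,
        (l%:E <= P [set w | `|T_ k w - x| < e]%R)%E) ->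
      (l%:E <= P' [set w | T w = x]%R)%E.
Proof.
have [U [UU oU [L FL]]] := ultralimit F01.
(* An enumeration of the rationals; codes of no rational are sent to 0. *)
pose q (i : nat) : R := ratr (odflt 0 (choice.unpickle i)).
have qP (x y : R) : x < y -> exists i, x < q i < y.
  move=> /rat_in_itvoo[r]; rewrite in_itv/= => xry.
  by exists (choice.pickle r); rewrite /q choice.pickleK.
have [s incs Fs] := ultralimit_subsequence q UU oU FL.
pose G := right_regularization L.
have ndG : {homo G : x y / x <= y} := regularization_nondecreasing ndF F01 UU FL.
have rcG : right_continuous G := regularization_right_continuous ndF F01 UU FL.
have G1 x : G x <= 1.
  apply: (regularization_upper F01 UU FL (y := x + 1)); first by rewrite ltrDl.
  by apply: nearW => k; case/andP: (F01 k (x + 1)).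
have G0 x : 0 <= G x.
  apply: (regularization_lower ndF UU FL).
  by apply: nearW => k; case/andP: (F01 k x).
have Gy : G @ +oo --> (1 : R).
  apply/cvgrPdist_le => e e0; near=> x.
  have x0 : 0 < x by near: x; exact: nbhs_pinfty_gt.
  have xce : c / e <= x by near: x; apply: nbhs_pinfty_ge; exact: num_real.
  rewrite ger0_norm ?subr_ge0// lerBlDr addrC -lerBlDr.
  apply: (@le_trans _ _ (1 - c / x)).
    by rewrite lerB// ler_pdivrMr// mulrC -ler_pdivrMr.
  apply: (regularization_lower ndF UU FL).
  by apply: nearW => k; exact: F_upper.
have GN : G @ -oo --> (0 : R).
  apply/cvgrPdist_le => e e0; near=> x.
  have x0 : x < 0 by near: x; exact: nbhs_ninfty_lt.
  (* [G x] is bounded only through values of [F k] strictly to the right of [x]. The point [x / 2]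
     is taken there, which doubles the threshold. *)
  have xce : x <= - (2 * (c / e)).
    by near: x; apply: nbhs_ninfty_le; exact: num_real.
  rewrite sub0r normrN ger0_norm//.
  have x20 : 0 < - (x / 2) by lra.
  apply: (@le_trans _ _ (c / - (x / 2))).
    apply: (regularization_upper F01 UU FL (y := x / 2)); first by lra.
    by apply: nearW => k; rewrite -[x / 2 in X in X <= _]opprK; exact: F_lower.
  rewrite ler_pdivrMr// mulrC -ler_pdivrMr//.
  by lra.
have [d' [Om' [P' [T cdfT]]]] := cdf_realization ndG rcG GN Gy.
exists s => //; exists d', Om', P', T; split.
  move=> r cr; rewrite cdfT.
  have cG : {for r, continuous G}.
    have -> : G = fine \o cdf T by apply/funext => z; rewrite /= cdfT.
    apply: fine_cvg; rewrite fineK ?cdfT//.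
    by rewrite -cdfT; exact: cr.
  have Fr := regularization_cvg ndF F01 UU FL qP Fs cG.
  apply: cvg_EFin; last exact: Fr.
  by apply: nearW => k; rewrite fin_num_measure.
move=> x l lP; apply: atom_ge => e e0.
rewrite cdf_itv; last by lra.
rewrite !cdfT -EFinB lee_fin.
(* Halving the radius leaves room between [x - e] and [x - e / 2], the gap that
   [regularization_diff] asks for. *)
apply: (@le_trans _ _ (G (x + e / 2) - G (x - e))); last first.
  by rewrite lerB// ndG//; lra.
apply: (regularization_diff ndF F01 UU FL (a := x - e / 2)); first by lra.
have e20 : 0 < e / 2 by rewrite divr_gt0.
apply: oU; apply: filterS (lP _ e20) => k /le_trans lk.
rewrite -lee_fin EFinB !FE -cdf_itv; last by lra.
apply: lk; rewrite le_measure ?inE//; last 2 first.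
- exact: measurable_funPTI.
- by move=> w /=; rewrite in_itv/= ltr_distl => /andP[-> /ltW ->].
rewrite (_ : [set w | _] = T_ k @^-1` `]x - e / 2, x + e / 2[).
  exact: measurable_funPTI.
by apply/seteqP; split=> w /=; rewrite in_itv/= ltr_distl.
Unshelve. all: by end_near. Qed.

End helly_cvg_in_distribution.

(** * Iterated lower limits *)

Section lower_limits.
Context (R : realType).
Local Open Scope ereal_scope.

Lemma near_le_limn_einf (u : nat -> \bar R) c :
  c < limn_einf u -> \forall n \near \oo, c <= u n.
Proof.
rewrite limn_einf_lim => cu.
have [N cN] : exists N, c < einfs u N.
  apply/not_existsP => einfc; move: cu; rewrite ltNge => /negP; apply.
  apply: lime_le; first exact: is_cvg_einfs.
  by apply: nearW => n; rewrite leNgt; apply/negP; exact: einfc.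
exists N => // n /= Nn; apply: (le_trans (ltW cN)).
by apply: ereal_inf_lbound; exists n.
Qed.

Lemma le_limn_einf (u : nat -> \bar R) c :
  (\forall n \near \oo, c <= u n) -> c <= limn_einf u.
Proof.
move=> [N _ cu]; rewrite limn_einf_lim; apply: lime_ge; first exact: is_cvg_einfs.
exists N => // n /= Nn; apply: le_ereal_inf_tmp => _ [m /= nm <-].
by apply: cu; exact: leq_trans nm.
Qed.

(** By monotonicity in [e], the limit at 0 is a lower bound for the lower limits at all [e > 0], so
    one constant [c] below it works for every [e]. The hypothesis and the first conclusion of the
    theorem both have this form. *)
Lemma lim_limn_einf_gt0P (u : R -> nat -> \bar R) :
  (forall n x y, (x <= y)%R -> u x n <= u y n) ->
  0 < lim (limn_einf (u e) @[e --> 0^'+]) <->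
  exists2 c : R, (0 < c)%R &
    forall e : R, (0 < e)%R -> \forall n \near \oo, c%:E <= u e n.
Proof.
move=> ndu; pose h e := limn_einf (u e).
have ndh x y : (x <= y)%R -> h x <= h y.
  move=> xy; rewrite /h !limn_einf_lim; apply: lee_lim; try exact: is_cvg_einfs.
  apply: nearW => n; apply: le_ereal_inf_tmp => _ [m /= nm <-].
  by apply: ge_ereal_inf; exists (u x m); [exists m|exact: ndu].
(* Monotonicity makes the limit exist, so [lim] is not a default value. *)
have cvgh : cvg (h e @[e --> 0^'+]).
  by apply: nondecreasing_at_right_is_cvge; near=> e; move=> *; exact: ndh.
split=> [l0|[c c0 cu]].
  set l := lim _ in l0.
  have [c c0 cl] : exists2 c : R, (0 < c)%R & c%:E < l.
    case: (l) l0 => [r|_|//].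
      rewrite lte_fin => r0; exists (r / 2)%R; first by rewrite divr_gt0.
      by rewrite lte_fin; lra.
    by exists 1%R => //; rewrite ltry.
  exists c => // e e0; apply: near_le_limn_einf; apply: (lt_le_trans cl).
  apply: lime_le => //; near=> x; apply: ndh.
  by near: x; exact: nbhs_right_le.
apply: (@lt_le_trans _ _ c%:E); first by rewrite lte_fin.
apply: lime_ge => //; near=> e.
by apply: le_limn_einf; apply: cu; near: e; exact: nbhs_right_gt.
Unshelve. all: by end_near. Qed.

End lower_limits.

(** * Choice of constants and conclusion along the subsequence *)

Lemma expectation_dist_lty (R : realType) (d : measure_display)
    (Om : measurableType d) (P : probability Om R) (X : {RV P >-> R}) (x0 : R) :
  ('E_P[fun w => `|X w|%R] < +oo)%E -> ('E_P[fun w => `|X w - x0|%R] < +oo)%E.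
Proof.
move=> EX.
have mnorm : measurable_fun setT (fun x : R => `|x|) by exact: normr_measurable.
have mX : measurable_fun setT (fun w => `|X w|) by exact: (measurableT_comp mnorm).
apply: (@le_lt_trans _ _ ('E_P[fun w => `|X w|%R] + `|x0|%:E)%E); last first.
  by rewrite lte_add_pinfty// ltry.
rewrite -(expectation_cst P `|x0|) unlock -ge0_integralD//; last 3 first.
- by apply/measurable_EFinP.
- by move=> w _; rewrite lee_fin.
- by apply/measurable_EFinP; exact: measurable_cst.
apply: ge0_le_integral => //.
- apply/measurable_EFinP; apply: (measurableT_comp mnorm).
  exact: measurable_funB.
- apply/measurable_EFinP; apply: measurable_funD => //; exact: measurable_cst.
by move=> w _; rewrite -EFinD lee_fin ler_normB.
Qed.

Theorem corollary1 (R : realType) (d : measure_display) (Om : measurableType d)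
    (P : probability Om R) (X Y : {RV P >-> R})
    (X_ Y_ : nat -> {RV P >-> R}) (x0 : R) :
  independent_pair P X Y ->
  (0 < P [set w | 0 < Y w]%R <= P [set w | 0 <= Y w]%R)%E ->
  P [set w | 0 <= Y w]%R = 1%E ->
  iid_copies P (fun i => pairRV (X_ i) (Y_ i)) (pairRV X Y) ->
  ('E_P[fun w => `|X w|%R] < +oo)%E ->
  (exists2 s : nat -> nat, subsequence s &
     (0 < lim (limn_einf (fun k => P (max_dominates Y_ (s k) eps))
                 @[eps --> 0^'+]))%E) ->
  (0 < P [set w | X w = x0]%R)%E ->
  (exists2 s : nat -> nat, subsequence s &
     (0 < lim (limn_einf (fun k =>
                   P [set w | self_normalized_sum X_ Y_ (s k) w
                                \in `]x0 - eps, x0 + eps[ ]%R)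
                 @[eps --> 0^'+]))%E)
  /\
  (exists2 s : nat -> nat, subsequence s &
     exists (d' : measure_display) (Om' : measurableType d')
            (P' : probability Om' R) (T : {RV P' >-> R}),
       cvg_in_distribution P P' (fun k => self_normalized_sum X_ Y_ (s k)) T
       /\ (0 < P' [set w | T w = x0]%R)%E).
Proof.
move=> indXY _ Y1 copies EX [s [incs s0] /= lim_dom] px0.
pose u e k := P (max_dominates Y_ (s k) e).
pose v e k := P [set w | self_normalized_sum X_ Y_ (s k) w \in `]x0 - e, x0 + e[].
have vE e k : v e k = P [set w | `|self_normalized_sum X_ Y_ (s k) w - x0| < e].
  by congr (P _); apply/seteqP; split=> w /=; rewrite in_itv/= ltr_distl.
have ndu k x y : x <= y -> (u x k <= u y k)%E.
  move=> xy; rewrite /u le_measure ?inE//; [exact: measurable_max_dominates..|].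
  by move=> w /=; apply: le_lt_trans; rewrite lerB.
have mv e k : measurable
    [set w | self_normalized_sum X_ Y_ (s k) w \in `]x0 - e, x0 + e[].
  rewrite (_ : [set w | _] =
    self_normalized_sum X_ Y_ (s k) @^-1` `]x0 - e, x0 + e[)//.
  exact: measurable_funPTI.
have ndv k x y : x <= y -> (v x k <= v y k)%E.
  move=> xy; rewrite /v le_measure ?inE// => w /=; rewrite !in_itv/=.
  by move=> /andP[? ?]; apply/andP; split; lra.
have [c c0 cu] := (lim_limn_einf_gt0P ndu).1 lim_dom.
have EXx0 := expectation_dist_lty x0 EX.
set p := fine (P [set w | X w = x0]).
have mx0 : measurable [set w | X w = x0].
  rewrite (_ : [set w | _] = X @^-1` [set x0])//; exact: measurable_funPTI.
have pE : P [set w | X w = x0] = p%:E by rewrite /p fineK// fin_num_measure.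
have p0 : 0 < p by rewrite -lte_fin -pE.
pose C := fine ('E_P[fun w => `|X w - x0|%R])%E.
have CE : ('E_P[fun w => `|X w - x0|%R] = C%:E)%E.
  by rewrite fineK// ge0_fin_numE//; apply: expectation_ge0.
have C0 : 0 <= C by rewrite -lee_fin -CE; apply: expectation_ge0.
have c'0 : 0 < p * c / 2 by rewrite divr_gt0// mulr_gt0.
(* For large [k], [max_dominates_close] gives [e * p * c <= e * v e k + eps * C]. Taking [eps * C]
   at most half of the left side leaves the other half as a lower bound. *)
have cv e : 0 < e -> \forall k \near \oo, ((p * c / 2)%:E <= v e k)%E.
  (* The denominator uses [C + 1] because [C] may be zero; the cap [2^-1] on [eps] is the range
     where the dominant events are disjoint. *)
  move=> e0; pose a := e * p * c / (2 * (C + 1)).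
  have a0 : 0 < a by rewrite divr_gt0 ?mulr_gt0// ltr_wpDl.
  pose eps := Num.min 2^-1 a.
  have eps0 : 0 < eps by rewrite lt_min invr_gt0 ltr0n.
  have epsC : eps * C <= e * p * c / 2.
    apply: (@le_trans _ _ (a * (C + 1))).
      by apply: ler_pM => //; [exact: ltW|rewrite ge_min lexx orbT|rewrite lerDl].
    rewrite /a invfM mulrA -mulrA mulVf ?mulr1//.
    by rewrite gt_eqF// ltr_wpDl.
  apply: filterS (cu _ eps0) => k cuk.
  have epsb : 0 <= eps <= 2^-1 by rewrite ltW//= ge_min lexx.
  have := max_dominates_close indXY copies Y1 x0 (s0 k) epsb e0.
  rewrite -vE pE CE -/(u eps k).
  have -> : u eps k = (fine (u eps k))%:E.
    by rewrite fineK// fin_num_measure//; exact: measurable_max_dominates.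
  have vk : v e k = (fine (v e k))%:E by rewrite fineK// fin_num_measure.
  have : c <= fine (u eps k).
    rewrite -lee_fin fineK// fin_num_measure//; exact: measurable_max_dominates.
  rewrite vk -!EFinM -EFinD !lee_fin => cuk' main.
  rewrite -(ler_pM2l e0).
  have : e * (p * c) <= e * (p * fine (u eps k)).
    by rewrite ler_pM2l// ler_pM2l.
  lra.
split; first by exists s => //; apply/(lim_limn_einf_gt0P ndv); exists (p * c / 2).
pose T_ k : {RV P >-> R} := self_normalized_sum X_ Y_ (s k).
pose K := fine ('E_P[fun w => `|X w|%R])%E.
have tight k (M : R) : 0 < M -> (M%:E * P [set w | M <= `|T_ k w|]%R <= K%:E)%E.
  move=> M0; rewrite fineK.
    exact: (self_normalized_sum_tail indXY copies Y1).
  by rewrite ge0_fin_numE//; apply: expectation_ge0.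
(* The selection is applied to the sums along [s], where the bound [cv] holds, so the final
   subsequence is [s \o r]. *)
have [r incr [d' [Om' [P' [T [cvgT atomT]]]]]] := helly_cvg_in_distribution tight.
exists (s \o r).
  by split=> [m n|k]; rewrite /= ?incs ?incr.
exists d', Om', P', T; split=> //.
apply: (@lt_le_trans _ _ (p * c / 2)%:E); first by rewrite lte_fin.
apply: atomT => e e0; apply: filterS (cv _ e0) => k.
by rewrite vE.
Qed.
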